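(* For every $n\ge 2$, there is a bijection between the set $\mathcal{UD}_{2n}(4123)$ and the set of shifted standard Young tableaux of shape $(n+2,n,n-2)$.
   Context: A permutation $\pi=\pi_1\cdots\pi_m$ of $[m]=\{1,\ldots,m\}$ is up-down alternating if $\pi_1<\pi_2>\pi_3<\pi_4>\cdots$; it avoids the pattern $4123$ if no subsequence $\pi_{i_1}\pi_{i_2}\pi_{i_3}\pi_{i_4}$ ($i_1<i_2<i_3<i_4$) satisfies $\pi_{i_2}<\pi_{i_3}<\pi_{i_4}<\pi_{i_1}$. $\mathcal{UD}_m(4123)$ is the set of $4123$-avoiding up-down alternating permutations of $[m]$. For a partition $\lambda=(\lambda_1>\lambda_2>\cdots)$ with distinct parts, the shifted Young diagram of shape $\lambda$ has $\lambda_i$ cells in row $i$, each row indented one cell to the right relative to the previous row (row $i$ occupies columns $i,\ldots,i+\lambda_i-1$; a part equal to $0$ gives an empty row). A shifted standard Young tableau is a filling of this diagram with $1,\ldots,|\lambda|$, each used once, increasing along rows and down columns. *)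

(* Defs.v *)
From HB Require Import structures.
From mathcomp Require Export all_boot all_fingroup.
Set Implicit Arguments.
Unset Strict Implicit.
Unset Printing Implicit Defensive.

(* Permutations of [m] are elements of 'S_m: positions and values are indexed
   from 0, so the first step, which must be an ascent, leaves position 0. *)
Definition updown (m : nat) (p : 'S_m) : bool :=
  [forall i : 'I_m, forall j : 'I_m, (j == i.+1 :> nat) ==>
     (if odd i then p j < p i else p i < p j)].

Definition avoids4123 (m : nat) (p : 'S_m) : bool :=
  ~~ [exists i1 : 'I_m, exists i2 : 'I_m, exists i3 : 'I_m, exists i4 : 'I_m,
      [&& i1 < i2, i2 < i3, i3 < i4, p i2 < p i3, p i3 < p i4 & p i4 < p i1]].

Definition UD4123 (m : nat) : {set 'S_m} :=
  [set p : 'S_m | updown p && avoids4123 p].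

(* Rows and columns are indexed from 0, so row i occupies the columns
   i, ..., i + la_i - 1; the bound on the column index makes the
   ambient type finite and excludes no cell. *)
Definition in_shifted_diagram (la : seq nat)
    (c : 'I_(size la) * 'I_(size la + sumn la)) : bool :=
  c.1 <= c.2 < c.1 + nth 0 la c.1.

Definition shifted_cell (la : seq nat) : finType :=
  {c : 'I_(size la) * 'I_(size la + sumn la) | in_shifted_diagram c}.

Definition cell_row (la : seq nat) (c : shifted_cell la) : nat := (val c).1.
Definition cell_col (la : seq nat) (c : shifted_cell la) : nat := (val c).2.

(* The entry k : 'I_(sumn la) stands for the label k + 1. *)
Definition shifted_SYT (la : seq nat) :
    {set {ffun shifted_cell la -> 'I_(sumn la)}} :=
  [set t : {ffun shifted_cell la -> 'I_(sumn la)} |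
    [&& [forall k : 'I_(sumn la), #|[set c | t c == k]| == 1],
        [forall c, forall d, (cell_row c == cell_row d) ==>
           (cell_col c < cell_col d) ==> (t c < t d)]
      & [forall c, forall d, (cell_col c == cell_col d) ==>
           (cell_row c < cell_row d) ==> (t c < t d)]]].

(* Main.v *)
Require Import Defs.
From mathcomp Require Import all_algebra.
From mathcomp Require Import zify ring lra.
Set Implicit Arguments.
Unset Strict Implicit.
Unset Printing Implicit Defensive.

(** Build a 4123-avoiding up-down permutation by inserting letters on the left.
    A new first letter [x] is legal as long as it lies below the "3" of every
    123-pattern, so only the values below the smallest such "3" stay alive.
    Row-inserting the letters into a tableau and cutting it at the first entry
    that would be bumped into a third row keeps track of exactly that: the alive
    values form a two-row standard tableau.  A peak is then precisely an
    insertion that cuts nothing, and over all tableaux of a given shape a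
    peak-valley pair amounts to removing some boxes one at a time and then adding
    a full column.  Hence the permutations of length [2n] are equinumerous with
    the standard tableaux of shape [(n, n, n)]; by the product formulas their
    number is also that of the shifted tableaux of shape [(n+2, n, n-2)]. *)

(** * Two-row tableaux and insertion *)

(* A two-row standard tableau with entries [0 .. k-1] is the list of the rows of
   its entries from [k-1] down to [0]: [false] is the first row, [true] the
   second.  Inserting at slot [x] raises the entries [>= x] by one.  The slot is
   [blocked] when the entry bumped from row 1 would bump one from row 2. *)

Fixpoint row1_above (r : seq bool) (x : nat) : bool :=
  if r is c :: r1 then (~~ c && (x <= size r1)) || row1_above r1 x else false.

Fixpoint blocked (r : seq bool) (x : nat) : bool :=
  if r is c :: r1 then blocked r1 x || c && row1_above r1 x else false.

Fixpoint tab_ins (r : seq bool) (x : nat) : seq bool :=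
  if r is c :: r1 then
    if size r < x.+1 then false :: r else (c || ~~ row1_above r1 x) :: tab_ins r1 x
  else [:: false].

(* Dropping the head of [r] cuts the tableau below its largest entry. *)
Fixpoint tab_step (r : seq bool) (x : nat) : seq bool :=
  if blocked r x then if r is _ :: r1 then tab_step r1 x else [::] else tab_ins r x.

Lemma row1_above_lt r x : row1_above r x -> x < size r.
Proof.
elim: r => //= c r IH /orP[/andP[_ ?]|/IH]; first by rewrite ltnS.
by move/leqW.
Qed.

Lemma blocked_row1_above r x : blocked r x -> row1_above r x.
Proof. by elim: r => //= c r IH /orP[/IH ->|/andP[_ ->]]; rewrite orbT. Qed.

Lemma ins_size r : tab_ins r (size r) = false :: r.
Proof. by case: r => //= c r; rewrite ltnSn. Qed.

Lemma ins_cons c r x :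
  x <= size r -> tab_ins (c :: r) x = (c || ~~ row1_above r x) :: tab_ins r x.
Proof. by move=> /= h; rewrite !ltnS ltnNge h. Qed.

Lemma le_sizeS_cases (r : seq bool) c x :
  x <= size (c :: r) -> x = size (c :: r) \/ x <= size r.
Proof. by rewrite leq_eqVlt => /orP[/eqP|]; [left|right]. Qed.

Lemma size_ins r x : x <= size r -> size (tab_ins r x) = (size r).+1.
Proof.
elim: r => // c r IH /le_sizeS_cases[->|h]; first by rewrite ins_size.
by rewrite ins_cons //= IH.
Qed.

Lemma row1_above_ins_gt r x y :
  ~~ row1_above r x -> x <= size r -> x < y -> ~~ row1_above (tab_ins r x) y.
Proof.
move=> h hx xy; elim: r h hx => [|c r IH] h hx; first by case: y xy.
case/le_sizeS_cases: (hx) => [ex|xr].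
  rewrite ex ins_size -[row1_above _ _]/((y <= size (c :: r)) || row1_above (c :: r) y) -ex.
  by rewrite leqNgt xy orFb; apply/negP => /row1_above_lt; rewrite -ex ltnNge ltnW.
rewrite ins_cons //; move: h => /=; rewrite xr andbT negb_or => /andP[/negbNE -> /=].
by move/IH; apply.
Qed.

(** If an entry is bumped, it ends row 2 and lies below every first-row entry that now exceeds [x];
    older second-row entries above a first-row one would already have blocked [x]. *)
Lemma blocked_ins_gt r x y :
  ~~ blocked r x -> x <= size r -> x < y -> ~~ blocked (tab_ins r x) y.
Proof.
move=> h hx xy; elim: r h hx => [|c r IH] h hx //.
case/le_sizeS_cases: (hx) => [ex|xr].
  rewrite ex ins_size -[blocked _ _]/(blocked (c :: r) y || false) orbF.
  by apply/negP => /blocked_row1_above/row1_above_lt; rewrite -ex ltnNge ltnW.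
rewrite ins_cons //; move: h => /=; rewrite negb_or => /andP[h1 h2].
rewrite negb_or IH //=; apply/negP => /andP[h3]; apply/negP/row1_above_ins_gt => //.
by case: c h2 h3 {hx IH}.
Qed.

(** Some second-row entry always ends up above the new entry: the bumped one or, if nothing is
    bumped, the old entries [>= x]. These exist because [x < size r], and then all lie in row 2. *)
Lemma blocked_ins_le r x y :
  ~~ blocked r x -> x < size r -> y <= x -> blocked (tab_ins r x) y.
Proof.
move=> h hx yx; elim: r h hx => [|c r IH] // h hx'; have hx : x <= size r by [].
rewrite ins_cons //=; move: hx; rewrite leq_eqVlt => /orP[/eqP ex|hx].
  have -> : ~~ row1_above r x by apply/negP => /row1_above_lt; rewrite ex ltnn.
  have yr : y <= size r by rewrite -ex.
  by rewrite ex ins_size orbT /= yr orbT.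
by rewrite IH //; move: h => /=; rewrite negb_or => /andP[].
Qed.

Lemma blocked_ins r x y :
  ~~ blocked r x -> x < size r -> blocked (tab_ins r x) y = (y <= x).
Proof.
move=> h hx; case: leqP => [yx|xy]; first exact: blocked_ins_le.
by apply/negbTE/blocked_ins_gt => //; apply: ltnW.
Qed.

Lemma tab_step_free r x : ~~ blocked r x -> tab_step r x = tab_ins r x.
Proof. by case: r => //= c r /negbTE ->. Qed.

Lemma tab_step_blocked c r x : blocked (c :: r) x -> tab_step (c :: r) x = tab_step r x.
Proof. by move=> /= ->. Qed.

(** * Sums over insertion slots and over tableaux of a given shape *)

Local Notation sumslots r P F :=
  (\sum_(0 <= x < (size r).+1) (if P x then F x else 0)).

Section Insertion.
Implicit Types phi : seq bool -> nat.

(** Slots are sorted by their effect on the shape: the new box lands in row 1 if nothing is bumped,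
    in row 2 if the bump stops there; the blocked slots are left to [ins_trunc]. *)
Definition ins_row1 phi r :=
  sumslots r (fun x => ~~ row1_above r x) (fun x => phi (tab_ins r x)).

Definition ins_row2 phi r :=
  sumslots r (fun x => row1_above r x && ~~ blocked r x) (fun x => phi (tab_ins r x)).
Definition ins_trunc phi r := sumslots r (blocked r) (fun x => phi (tab_step r x)).

Lemma row1_above_ge r x : size r <= x -> row1_above r x = false.
Proof. by move=> h; apply/negP => /row1_above_lt; rewrite ltnNge h. Qed.

Lemma blocked_ge r x : size r <= x -> blocked r x = false.
Proof. by move=> h; apply/negP => /blocked_row1_above; rewrite row1_above_ge. Qed.

Lemma ins_row1_nil phi : ins_row1 phi [::] = phi [:: false].
Proof. by rewrite /ins_row1 big_nat1. Qed.

Lemma ins_row1_cons phi c r :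
  ins_row1 phi (c :: r) =
  phi [:: false, c & r] + if c then ins_row1 (phi \o cons true) r else 0.
Proof.
rewrite /ins_row1 big_nat_recr //= row1_above_ge // ltnn andbF ltnSn addnC; congr (_ + _).
case: c => /=.
  by apply: eq_big_nat => x /andP[_ hx]; rewrite ltnNge hx.
by rewrite big_nat_cond big1 // => x /andP[/andP[_ hx] _]; rewrite -ltnS hx.
Qed.

Lemma ins_row2_nil phi : ins_row2 phi [::] = 0.
Proof. by rewrite /ins_row2 big_nat1. Qed.

Lemma ins_row2_cons phi c r :
  ins_row2 phi (c :: r) =
  if c then 0 else ins_row1 (phi \o cons true) r + ins_row2 (phi \o cons false) r.
Proof.
rewrite /ins_row2 big_nat_recr //= row1_above_ge // ltnn andbF /= addn0.
case: c => /=.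
  by rewrite big1_seq // => x _; case: row1_above; rewrite //= !orbT.
rewrite -big_split; apply: eq_big_nat => x /andP[_ hx].
rewrite -ltnS hx orbF /= ltnNge hx /=.
case h1: (row1_above r x) => /=; first by rewrite add0n.
by case h2: (blocked r x) => /=; [rewrite blocked_row1_above in h1|rewrite addn0].
Qed.

Lemma ins_trunc_nil phi : ins_trunc phi [::] = 0.
Proof. by rewrite /ins_trunc big_nat1. Qed.

(** A slot blocked in [c :: r] but not in [r] is blocked by the largest entry alone, which lies in
    row 2. Once that entry is cut, an ordinary insertion ending in row 2 remains. *)
Lemma ins_trunc_cons phi c r :
  ins_trunc phi (c :: r) = ins_trunc phi r + if c then ins_row2 phi r else 0.
Proof.
rewrite /ins_trunc big_nat_recr //= blocked_ge // row1_above_ge //.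
rewrite andbF addn0; case: c => /=; last first.
  by rewrite addn0; apply: eq_bigr => x _; case: (blocked r x).
rewrite -big_split; apply: eq_bigr => x _ /=.
case h2: (blocked r x); first by rewrite andbF addn0.
rewrite andbT add0n; case: row1_above; rewrite //=; by rewrite ?tab_step_free ?h2.
Qed.

(* Sum of [phi] over the ballot words of length [n] with [b] letters [true]. *)
Fixpoint ballot_sum phi n b : nat :=
  if n is n'.+1 then
    if b.*2 <= n then
      ballot_sum (phi \o cons false) n' b
      + (if b is b'.+1 then ballot_sum (phi \o cons true) n' b' else 0)
    else 0
  else if b is 0 then phi [::] else 0.

Lemma ballot_sum_big phi n b : n < b.*2 -> ballot_sum phi n b = 0.
Proof. by case: n => [|n] /=; [case: b|rewrite ltnNge => /negbTE ->]. Qed.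

Lemma eq_ballot_sum phi psi n b : phi =1 psi -> ballot_sum phi n b = ballot_sum psi n b.
Proof.
elim: n b phi psi => [|n IH] [|b] phi psi e //=; first by rewrite !addn0; apply: IH => ?; apply: e.
by case: ifP => // _; congr (_ + _); apply: IH => ?; apply: e.
Qed.

Lemma ballot_sumD phi psi n b :
  ballot_sum (fun r => phi r + psi r) n b = ballot_sum phi n b + ballot_sum psi n b.
Proof.
elim: n b phi psi => [|n IH] b phi psi /=; first by case: b.
case: ifP => // _; case: b => [|b]; first by rewrite !addn0 -IH.
by rewrite addnACA -!IH.
Qed.

Lemma ballot_sum0 n b : ballot_sum (fun=> 0) n b = 0.
Proof.
elim: n b => [|n IH] [|b] //=; first by rewrite addn0; apply: IH.
by case: ifP => // _; rewrite [X in X + _]IH [X in _ + X]IH.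
Qed.

(** Row insertion is reversible: a tableau of the larger shape, together with the corner to be
    removed, determines the smaller tableau and the slot. For [b.*2 = n.+1] the left side would be
    an empty sum, while the right side need not be. *)
Lemma ballot_sum_ins_row1 phi n b :
  b.*2 <= n -> ballot_sum (ins_row1 phi) n b = ballot_sum phi n.+1 b.
Proof.
elim: n b phi => [|n IH] b phi hb.
  by case: b hb => //= _; rewrite ins_row1_nil addn0.
rewrite [LHS]/= hb (@eq_ballot_sum _ (phi \o cons false \o cons false)); last first.
  by move=> r /=; rewrite ins_row1_cons addn0.
rewrite [RHS]/= (leqW hb) hb.
case: b hb => [|b] hb; first by rewrite !addn0.
rewrite (@eq_ballot_sum (ins_row1 phi \o cons true) (fun r =>
   (phi \o cons false \o cons true) r + ins_row1 (phi \o cons true) r)); last first.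
  by move=> r /=; rewrite ins_row1_cons.
rewrite ballot_sumD IH; last by lia.
by rewrite addnA.
Qed.

Lemma ballot_sum_ins_row2 phi n b :
  ballot_sum (ins_row2 phi) n b = ballot_sum phi n.+1 b.+1.
Proof.
elim: n b phi => [|n IH] b phi; first by case: b => //=; rewrite ins_row2_nil.
case: (leqP b.*2 n.+1) => hb; last by rewrite !ballot_sum_big //; lia.
rewrite [LHS]/= hb.
rewrite (@eq_ballot_sum (ins_row2 phi \o cons false) (fun r =>
   ins_row1 (phi \o cons true) r + ins_row2 (phi \o cons false) r)); last first.
  by move=> r /=; rewrite ins_row2_cons.
rewrite ballot_sumD IH.
have -> : (if b is b'.+1 then ballot_sum (ins_row2 phi \o cons true) n b' else 0) = 0.
  case: b {hb} => // b; rewrite (@eq_ballot_sum _ (fun=> 0)) ?ballot_sum0 // => r /=.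
  by rewrite ins_row2_cons.
rewrite addn0; case: (leqP b.*2 n) => hb'.
  rewrite ballot_sum_ins_row1 // addnC [RHS]/ballot_sum -/ballot_sum ifT //; lia.
by rewrite ballot_sum_big // [in RHS]ballot_sum_big ?ballot_sum_big //; lia.
Qed.

(** Splits on the row of the largest entry. The last term collects the slots blocked by that entry
    alone: the cut removes a box of row 2 and the insertion restores it, so each tableau of the
    shape is reached once. *)
Lemma ballot_sum_ins_trunc phi n b :
  b.*2 <= n.+1 -> ballot_sum (ins_trunc phi) n.+1 b =
  ballot_sum (ins_trunc phi) n b +
  if b is b'.+1 then ballot_sum (ins_trunc phi) n b' + ballot_sum phi n.+1 b else 0.
Proof.
move=> hb; rewrite [LHS]/= hb; congr (_ + _).
  by apply: eq_ballot_sum => r /=; rewrite ins_trunc_cons addn0.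
case: b hb => // b hb; rewrite -ballot_sum_ins_row2 -ballot_sumD.
by apply: eq_ballot_sum => r /=; rewrite ins_trunc_cons.
Qed.

Lemma ballot_sum_ins_trunc0 phi n : ballot_sum (ins_trunc phi) n 0 = 0.
Proof. by elim: n => [|n IH]; rewrite ?ballot_sum_ins_trunc ?IH //= ins_trunc_nil. Qed.

(** The slot [x] of the peak cuts nothing; the valley slot satisfies [y <= x] because the letter [x]
    becomes [x + 1] when [y] is put in front of it. *)
Definition add_pair phi r :=
  \sum_(0 <= x < (size r).+1)
     if blocked r x then 0 else \sum_(0 <= y < x.+1) phi (tab_step (tab_ins r x) y).

(** For [x < size r] the slots [y <= x] are exactly the blocked ones of the new tableau. For
    [x = size r] all slots up to [size r] are allowed, and the unblocked ones among them give the
    first summand. *)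
Lemma add_pairE phi r :
  add_pair phi r = ins_row2 phi (false :: r)
    + ins_row1 (ins_trunc phi) r + ins_row2 (ins_trunc phi) r.
Proof.
rewrite -addnA.
have -> : ins_row1 (ins_trunc phi) r + ins_row2 (ins_trunc phi) r =
   \sum_(0 <= x < (size r).+1) if blocked r x then 0 else ins_trunc phi (tab_ins r x).
  rewrite -big_split; apply: eq_bigr => x _ /=.
  case h2: (blocked r x); first by rewrite andbF (blocked_row1_above h2).
  by case: (row1_above r x); rewrite ?addn0.
rewrite /add_pair [LHS]big_nat_recr // [X in _ = _ + X]big_nat_recr //=.
rewrite blocked_ge // ins_size [RHS]addnCA; congr (_ + _).
  apply: eq_big_nat => x /andP[_ hx]; case: ifP => // /negbT h.
  rewrite /ins_trunc size_ins 1?ltnW // [RHS](big_cat_nat (n := x.+1)) //=; last by lia.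
  rewrite [X in _ + X]big_nat_cond [X in _ + X]big1 ?addn0; last first.
    by move=> y /andP[/andP[h1 _] _]; rewrite blocked_ins // leqNgt h1.
  by apply: eq_big_nat => y /andP[_ hy]; rewrite blocked_ins // -ltnS hy.
rewrite /ins_row2 /ins_trunc /= !(big_nat_recr (size r).+1) //=.
rewrite row1_above_ge // blocked_ge // ltnn !addn0 /=.
rewrite -big_split; apply: eq_big_nat => y /andP[_ hy] /=.
have -> : y <= size r by [].
by rewrite orbF; case: (blocked r y); rewrite //= addn0.
Qed.

(* The idea: adding one box to a shape is the same as adding a full column and then
   removing one box. *)
Lemma ballot_sum_add_pair phi n b :
  b.*2 <= n -> ballot_sum (add_pair phi) n b = ballot_sum (ins_trunc phi) n.+2 b.+1.
Proof.
move=> hb; rewrite (eq_ballot_sum _ _ (add_pairE phi)) ballot_sumD ballot_sumD.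
rewrite ballot_sum_ins_row1 // ballot_sum_ins_row2 [RHS]ballot_sum_ins_trunc; last by lia.
(* Prescribing [false] as head loses nothing: when the largest entry lies in row 2, every slot that
   bumps is blocked, so [ins_row2] vanishes. *)
have -> : ballot_sum (fun r => ins_row2 phi (false :: r)) n b = ballot_sum phi n.+2 b.+1.
  rewrite -ballot_sum_ins_row2 [RHS]/= ifT; last by lia.
  rewrite -[LHS]addn0; congr (_ + _); case: b {hb} => // b.
  by rewrite (@eq_ballot_sum _ (fun=> 0)) ?ballot_sum0 // => r /=; rewrite ins_row2_cons.
by rewrite addnC [X in _ + X]addnC.
Qed.

(** * Three-row tableaux and the hook length formula *)

Fixpoint pairings k : seq bool -> nat :=
  if k is k'.+1 then add_pair (pairings k') else fun=> 1.

(** Read [ballot_sum (pairings k) n b] as the number of standard tableaux of shape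
    [(n - b + k, b + k, k)]. The three terms then remove the largest entry from row 3, row 1 and row
    2. *)
Lemma ballot_sum_pairingsS k n b : b.*2 <= n ->
  ballot_sum (pairings k.+1) n b = ballot_sum (pairings k) n.+2 b.+1 +
  (if n is n'.+1 then
     ballot_sum (pairings k.+1) n' b + (if b is b'.+1 then ballot_sum (pairings k.+1) n' b' else 0)
   else 0).
Proof.
have U0 m c : m < c.*2 -> ballot_sum (ins_trunc (pairings k)) m c = 0 by exact: ballot_sum_big.
move=> hb; rewrite [pairings k.+1]/= ballot_sum_add_pair // ballot_sum_ins_trunc; last by lia.
case: n hb => [|n] hb.
  have -> : b = 0 by lia.
  by rewrite U0 // ballot_sum_ins_trunc0 addn0.
rewrite addnA addnC; congr (_ + (_ + _)).
  case: (leqP b.*2 n) => h; first by rewrite ballot_sum_add_pair.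
  by rewrite !ballot_sum_big //; lia.
by case: b hb => [|b] hb; [rewrite ballot_sum_ins_trunc0|rewrite ballot_sum_add_pair //; lia].
Qed.

(* Strips the common factor [(c + 2b + 3k - 1)!] off the recurrence for the hook
   length formula of the shape [(c + b + k, b + k, k)]. *)
Lemma hook_recurrence k c b N : N = c + b.*2 + k * 3 ->
  (c + b + k).+2 * (c * b.+1 * (c + b).+1)
  + (b + k).+1 * (c.+2 * b * (c + b).+2) + k * (c.+1 * b.+2 * (c + b).+3)
  = N * (c.+1 * b.+1 * (c + b).+2).
Proof. by move=> ->; rewrite -muln2; ring. Qed.

(** The same recurrence with [c = n - 2b], the difference of the first two rows. For [k = 0] it is
    the recursion of [ballot_sum] itself. *)
Lemma ballot_sum_pairings_rec k c b : 0 < c + b.*2 + k * 3 ->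
  ballot_sum (pairings k) (c + b.*2) b =
  (if c is c'.+1 then ballot_sum (pairings k) (c' + b.*2) b else 0) +
  (if b is b'.+1 then ballot_sum (pairings k) (c.+1 + b'.*2) b' else 0) +
  (if k is k'.+1 then ballot_sum (pairings k') (c + b.+1.*2) b.+1 else 0).
Proof.
case: k => [|k].
  rewrite addn0 addn0; case e: (c + b.*2) => [|n] // _.
  rewrite [LHS]/= ifT; last by lia.
  congr (_ + _).
    case: c e => [|c] e; first by rewrite ballot_sum_big //; lia.
    by have -> : c + b.*2 = n by lia.
  case: b e => [|b] e //.
  by have -> : c.+1 + b.*2 = n by lia.
move=> _; rewrite ballot_sum_pairingsS; last by lia.
rewrite addnC; have -> : c + b.+1.*2 = (c + b.*2).+2 by lia.
congr (_ + _); case e: (c + b.*2) => [|n].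
  by have [-> ->] : c = 0 /\ b = 0 by lia.
congr (_ + _).
  case: c e => [|c] e; first by rewrite ballot_sum_big //; lia.
  by have -> : c + b.*2 = n by lia.
case: b e => [|b] e //.
by have -> : c.+1 + b.*2 = n by lia.
Qed.

(** The hook length formula for [(c + b + k, b + k, k)] in Frobenius form: the factorials are those
    of the row lengths shifted by 2, 1, 0, and the three last factors are the differences of these
    shifted lengths. Induction on the number of boxes. *)
Lemma ballot_sum_pairings k c b :
  ballot_sum (pairings k) (c + b.*2) b * ((c + b + k).+2`! * (b + k).+1`! * k`!) =
  (c + b.*2 + k * 3)`! * (c.+1 * b.+1 * (c + b).+2).
Proof.
move: {2}(c + b.*2 + k * 3) (erefl (c + b.*2 + k * 3)) => N.
elim: N k c b => [|N IH] k c b e.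
  by have [-> [-> ->]] : c = 0 /\ b = 0 /\ k = 0 by lia.
rewrite ballot_sum_pairings_rec; last by rewrite e.
rewrite [LHS]mulnDl [X in X + _]mulnDl e [in RHS]factS.
rewrite -[RHS]mulnA [RHS]mulnCA -(hook_recurrence (esym e)).
rewrite [RHS]mulnDr [X in _ = X + _]mulnDr; congr (_ + _ + _).
- case: c e => [|c] e; first by rewrite !(mul0n, muln0).
  have e' : c + b.*2 + k * 3 = N by lia.
  have := IH k c b e'; rewrite e' => h.
  rewrite [RHS]mulnCA -h !addSn [(c + b + k).+3`!]factS; ring.
- case: b e => [|b] e; first by rewrite !(mul0n, muln0).
  have e' : c.+1 + b.*2 + k * 3 = N by lia.
  have := IH k c.+1 b e'; rewrite e' => h.
  rewrite !addnS !addSn in h *.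
  rewrite [RHS]mulnCA -h [(b + k).+2`!]factS; ring.
- case: k e => [|k] e; first by rewrite !(mul0n, muln0).
  have e' : c + b.+1.*2 + k * 3 = N by lia.
  have := IH k c b.+1 e'; rewrite e' => h.
  rewrite !addnS !addSn in h *.
  rewrite [RHS]mulnCA -h [k.+1`!]factS; ring.
Qed.

(** The rectangle [(n, n, n)]: the only tableau to sum over is the empty one. *)
Lemma pairings_nil n :
  pairings n [::] * (n.+2`! * n.+1`! * n`!) = 2 * (n * 3)`!.
Proof. by rewrite [RHS]mulnC; exact: ballot_sum_pairings n 0 0. Qed.

End Insertion.

(** * Left insertion into permutations *)

(** These are the pairs that become a 123-pattern, with largest letter at most [k], once [x] is put
    in front. *)
Definition has12 (w : seq nat) (x k : nat) : Prop :=
  exists y z, subseq [:: y; z] w /\ x <= y < z /\ z < k.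

Definition has123 (w : seq nat) (k : nat) : Prop :=
  exists a b c, subseq [:: a; b; c] w /\ a < b < c /\ c < k.

Definition has4123 (w : seq nat) : Prop :=
  exists d a b c, subseq [:: d; a; b; c] w /\ a < b < c /\ c < d.

Definition push (x : nat) (w : seq nat) : seq nat := x :: map (bump x) w.

Lemma subseq_consP (T : eqType) (x y : T) s w :
  subseq (y :: s) (x :: w) <-> (y = x /\ subseq s w) \/ subseq (y :: s) w.
Proof.
split=> [/=|[[-> h]|h]]; last 2 first.
- by rewrite /= eqxx.
- exact: subseq_trans h (subseq_cons w x).
by case: eqP => [->|_] h; [left|right].
Qed.

Lemma subseq_mapP (T U : eqType) (f : T -> U) s w :
  subseq s (map f w) <-> exists2 s', s = map f s' & subseq s' w.
Proof.
split=> [/subseqP[m _ ->]|[s' -> h]]; last exact: map_subseq.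
by exists (mask m w); rewrite ?map_mask // mask_subseq.
Qed.

Lemma ltn_bump2 x a b : (bump x a < bump x b) = (a < b).
Proof. by rewrite !ltnNge leq_bump2. Qed.

Lemma has12_push w x y k : has12 (push x w) y k <->
  (y <= x /\ exists2 z, z \in w & x <= z /\ z.+1 < k) \/
  exists a b, subseq [:: a; b] w /\ y <= bump x a < bump x b /\ bump x b < k.
Proof.
split=> [[a [b [/subseq_consP[[->]|] h1 [/andP[h2 h3] h4]]]]|[[h1 [z h2 [h3 h4]]]|[a [b [h1 [h2 h3]]]]]].
- left; split=> //; move: h1; rewrite sub1seq => /mapP[z h1 h5].
  by exists z => //; move: h3 h4; rewrite h5 /bump; case: leqP; lia.
- right; have /subseq_mapP[[|a' [|b' []]] // [ea eb] h5] := h1.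
  by exists a', b'; rewrite -ea -eb h2 h3.
- exists x, z.+1; split; last by lia.
  apply/subseq_consP; left; split=> //; rewrite sub1seq.
  by apply/mapP; exists z => //; rewrite /bump h3.
- exists (bump x a), (bump x b); split=> //.
  by apply/subseq_consP; right; apply/subseq_mapP; exists [:: a; b].
Qed.

Lemma has123_push w x k : has123 (push x w) k <->
  (exists a b, subseq [:: a; b] w /\ x <= a < b /\ b.+1 < k) \/
  exists a b c, subseq [:: a; b; c] w /\ a < b < c /\ bump x c < k.
Proof.
split=> [[a [b [c [/subseq_consP[[->]|] h1 [h2 h3]]]]]|[[b [c [h1 [h2 h3]]]]|[a [b [c [h1 [h2 h3]]]]]]].
- left; have /subseq_mapP[[|b' [|c' []]] // [eb ec] h5] := h1.
  by exists b', c'; split=> //; rewrite eb ec /bump in h2 h3; lia.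
- right; have /subseq_mapP[[|a' [|b' [|c' []]]] // [ea eb ec] h5] := h1.
  by exists a', b', c'; split=> //; rewrite ea eb ec !ltn_bump2 in h2 h3.
- exists x, (bump x b), (bump x c); split; last by rewrite /bump; lia.
  by apply/subseq_consP; left; split=> //; apply/subseq_mapP; exists [:: b; c].
- exists (bump x a), (bump x b), (bump x c); split; last by rewrite !ltn_bump2.
  by apply/subseq_consP; right; apply/subseq_mapP; exists [:: a; b; c].
Qed.

(** The new first letter can only play the 4, and the letters below it are not shifted. *)
Lemma has4123_push w x : has4123 (push x w) <-> has4123 w \/ has123 w x.
Proof.
split=> [[d [a [b [c [/subseq_consP[[->]|] h1 [h2 h3]]]]]]|[[d [a [b [c [h1 [h2 h3]]]]]]|[a [b [c [h1 [h2 h3]]]]]]].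
- right; have /subseq_mapP[[|a' [|b' [|c' []]]] // [ea eb ec] h5] := h1.
  by exists a', b', c'; split=> //; rewrite ea eb ec /bump in h2 h3; lia.
- left; have /subseq_mapP[[|d' [|a' [|b' [|c' []]]]] // [ed ea eb ec] h5] := h1.
  by exists d', a', b', c'; split=> //; rewrite ed ea eb ec !ltn_bump2 in h2 h3.
- exists (bump x d), (bump x a), (bump x b), (bump x c); split; last by rewrite !ltn_bump2.
  by apply/subseq_consP; right; apply/subseq_mapP; exists [:: d; a; b; c].
- exists x, (bump x a), (bump x b), (bump x c); split; last by rewrite /bump; lia.
  by apply/subseq_consP; left; split=> //; apply/subseq_mapP; exists [:: a; b; c].
Qed.

Definition permword (w : seq nat) : Prop := uniq w /\ forall v, (v \in w) = (v < size w).

Lemma permword_push w x : permword w -> x <= size w -> permword (push x w).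
Proof.
move=> [uw mw] hx; split.
  rewrite /= map_inj_uniq ?uw ?andbT; last exact: can_inj (@bumpK x).
  by apply/mapP => [[v _]]; rewrite /bump; case: leqP; lia.
move=> v; rewrite /= size_map in_cons; case: eqP => [->|nvx] /=; first by rewrite ltnS hx.
apply/mapP/idP => [[u]|hv]; first by rewrite mw /bump => ? ->; case: leqP; lia.
exists (unbump x v); last by rewrite unbumpK // inE; apply/eqP.
by rewrite mw /unbump; case: ltnP; lia.
Qed.

(* Quantifying over the suffixes of [r] makes the statement about the values below
   every threshold, which is what survives a cut. *)
Fixpoint tracks (w : seq nat) (r : seq bool) : Prop :=
  (forall x, has12 w x (size r) <-> blocked r x) /\
  (if r is _ :: r1 then tracks w r1 else True).

Lemma tracks_blocked w r x : tracks w r -> has12 w x (size r) <-> blocked r x.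
Proof. by case: r => [|c r] []. Qed.

Lemma tracksI w r :
  (forall x, has12 w x (size r) <-> blocked r x) -> tracks w (behead r) -> tracks w r.
Proof. by case: r. Qed.

Lemma tracks_push_le w r x : tracks w r -> size r <= x -> tracks (push x w) r.
Proof.
elim: r => [|c r IH] [h1 h2] hx; last first.
  split; last by apply: IH => //; apply: ltnW.
  move=> y; rewrite -h1 has12_push; split=> [[[_ [z]]|[a [b [h3]]]]|[a [b [h3 h4]]]]; first lia.
    by move=> h4; exists a, b; split=> //; rewrite /bump in h4; lia.
  by right; exists a, b; split=> //; rewrite /bump; lia.
by split=> // y; split=> // -[a [b [_ []]]].
Qed.

Lemma tracks_push_blocked w r x y : permword w ->
  (forall z, has12 w z (size r) <-> blocked r z) -> ~~ blocked r x ->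
  x <= size r -> size r <= size w ->
  has12 (push x w) y (size r).+1 <-> blocked (tab_ins r x) y.
Proof.
move=> [_ mw] hr nh; rewrite leq_eqVlt => /orP[/eqP ex|xr] rw.
  rewrite ex ins_size -[blocked _ _]/(blocked r y || false) orbF -hr has12_push.
  split=> [[[_ [z _]]|[a [b [h1 h2]]]]|[a [b [h1 h2]]]]; first lia.
    by exists a, b; split=> //; rewrite /bump in h2; lia.
  by right; exists a, b; split=> //; rewrite /bump; lia.
rewrite blocked_ins // has12_push; split=> [[[]//|[a [b [h1 h2]]]]|yx]; last first.
  (* The old letter [x], present because [w] is a permutation, is shifted to [x + 1] and forms a
     12-pattern with the new first letter. *)
  by left; split=> //; exists x; rewrite ?mw //; lia.
rewrite leqNgt; apply/negP => xy; move/negP: nh; apply; apply/hr; exists a, b.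
by split=> //; rewrite /bump in h2; lia.
Qed.

Lemma tracks_ins w r x : permword w -> tracks w r -> ~~ blocked r x ->
  x <= size r -> size r <= size w -> tracks (push x w) (tab_ins r x).
Proof.
move=> pw; elim: r => [|c r IH] tr nh hx rw.
  split; last by split=> // y; split=> // -[a [b [_ []]]].
  move=> y; have := @tracks_push_blocked w [::] x y pw; apply=> //; by case: tr.
apply: tracksI.
  move=> y; have -> : size (tab_ins (c :: r) x) = (size (c :: r)).+1 by exact: size_ins.
  by apply: tracks_push_blocked => //; case: tr.
case/le_sizeS_cases: (hx) => [ex|xr].
  by rewrite ex ins_size; apply: tracks_push_le.
rewrite ins_cons //; apply: IH => //; last exact: ltnW.
  by case: tr.
by move: nh => /=; rewrite negb_or => /andP[].
Qed.

(** The tableau that receives [x] is the longest suffix [r1] of [r] that does not block it. If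
    something was cut, the last cut exhibits a 12-pattern of values between [x] and [size r1], hence
    a new 123-pattern with largest letter at most [size r1 + 1]. *)
Lemma tab_step_ins w r x : tracks w r -> x <= size r ->
  exists r1, [/\ tab_step r x = tab_ins r1 x, ~~ blocked r1 x, x <= size r1, tracks w r1
    & row1_above r x -> row1_above r1 x] /\
  (r1 = r \/ size r1 < size r /\ has12 w x (size r1).+1).
Proof.
elim: r => [|c r IH] tr hx.
  by exists [::]; split; [split|left].
case: (boolP (blocked (c :: r) x)) => h; last first.
  by exists (c :: r); split; [split=> //; rewrite tab_step_free|left].
have h1 : row1_above r x.
  by move: h => /= /orP[/blocked_row1_above|/andP[]].
case: IH => [||r1 [[e n1 x1 t1 hr1] h2]]; [by case: tr|exact/ltnW/row1_above_lt|].
exists r1; split; first by split=> //; [rewrite tab_step_blocked|move=> _; apply: hr1].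
right; case: h2 => [->|[h3 h4]]; last by split=> //; apply: leqW.
by split=> //; apply/(tracks_blocked _ tr).
Qed.

(** By [state_cut], [size r] is the smallest value playing the 3 of a 123-pattern, or [size w] if
    there is no such pattern; the bound on [k] accounts for the latter case. *)
Record state_of (w : seq nat) (r : seq bool) : Prop := StateOf {
  state_perm : permword w;
  state_size : size r <= size w;
  state_tracks : tracks w r;
  state_cut : forall k, k <= size w -> has123 w k <-> size r < k }.

Lemma state_of_nil : state_of [::] [::].
Proof.
split=> //; first by split=> // x; split=> // -[a [b []]].
by move=> k; rewrite leqn0 => /eqP ->; split=> // -[a [b [c []]]].
Qed.

Lemma state_of_push w r x :
  state_of w r -> x <= size r -> state_of (push x w) (tab_step r x).
Proof.
move=> [pw rw tr cut] hx; have [r1 [[e nh x1 t1 _] h]] := tab_step_ins tr hx.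
have r1r : size r1 <= size r by case: h => [->|[/ltnW]].
have r1w : size r1 <= size w by exact: leq_trans rw.
rewrite e; split.
- by apply: permword_push => //; apply: leq_trans rw.
- by rewrite size_ins //= size_map.
- exact: tracks_ins.
rewrite /= size_map size_ins // => k hk; rewrite has123_push; split.
  move=> [[a [b [h1 h2]]]|[a [b [c [h1 [h2 h3]]]]]]; rewrite ltnNge; apply/negP => hk1.
    by move/negP: nh; apply; apply/(tracks_blocked _ t1); exists a, b; split=> //; lia.
  have cw : c \in w by apply: (mem_subseq h1); rewrite !inE eqxx !orbT.
  (* An old pattern has [size r <= c], and [x <= size r], so its largest letter becomes [c + 1], too
     large to lie below [k]. *)
  have : size r < c.+1.
    rewrite -cut; last by move: cw; case: pw => _ ->.
    by exists a, b, c.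
  by move: h3; rewrite /bump; lia.
move=> hk1; case: h => [er|[_ h2]]; last first.
  have [a [b [h3 h4]]] := h2.
  by left; exists a, b; split=> //; lia.
(* Nothing was cut, so an old pattern serves; its largest letter rises by at most one, whence
   [k.-1]. *)
have [a [b [c [h3 h4]]]] : has123 w k.-1 by apply/cut; rewrite -?er; lia.
by right; exists a, b, c; split=> //; rewrite /bump; lia.
Qed.

(** * Codes of alternating 4123-avoiding words *)

Fixpoint alternates (down : bool) (w : seq nat) : bool :=
  if w is x :: w1 then
    (if w1 is y :: _ then if down then y < x else x < y else true)
    && alternates (~~ down) w1
  else true.

(* A code lists the slots of the successive left insertions, the last one first. *)
Fixpoint code_word (c : seq nat) : seq nat :=
  if c is x :: c1 then push x (code_word c1) else [::].

Fixpoint code_state (c : seq nat) : seq bool :=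
  if c is x :: c1 then tab_step (code_state c1) x else [::].

Fixpoint is_code (c : seq nat) : bool :=
  if c is x :: c1 then (x <= size c1) && is_code c1 else true.

Fixpoint pair_code (c : seq nat) : bool :=
  if c is y :: c1 then
    if c1 is x :: c2 then
      [&& pair_code c2, x <= size (code_state c2), ~~ blocked (code_state c2) x & y <= x]
    else false
  else true.

Lemma size_code_word c : size (code_word c) = size c.
Proof. by elim: c => //= x c IH; rewrite size_map IH. Qed.

Lemma alternates_bump x b w : alternates b (map (bump x) w) = alternates b w.
Proof.
elim: w b => //= y w IH b; rewrite IH; congr (_ && _).
by case: w {IH} => //= z w; rewrite !ltnNge !leq_bump2.
Qed.

(** The last component identifies peaks: after a valley, the blocked slots are those not exceeding
    the first letter, so a descent from the new letter to the old first letter means that nothing is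
    cut. *)
Lemma pair_code_state c : pair_code c ->
  [/\ is_code c, state_of (code_word c) (code_state c)
    & forall x, blocked (code_state c) x = (c != [::]) && (x <= head 0 (code_word c))].
Proof.
move: {2}(size c) (leqnn (size c)) => n; elim: n c => [|n IH] [|y [|x c]] //.
- by move=> _ _; split=> //; exact: state_of_nil.
- by move=> _ _; split=> //; exact: state_of_nil.
rewrite /= ltnS => hc /and4P[pc xr nh yx].
have [ic sc hh] := IH c (ltnW hc) pc.
have xc : x <= size c by rewrite -size_code_word; apply: leq_trans xr (state_size sc).
have s1 := state_of_push sc xr.
have yr : y <= size (tab_step (code_state c) x) by rewrite tab_step_free // size_ins //; apply: leqW; lia.
split; first by rewrite ic xc /= (leq_trans yx) // leqW.
  exact: state_of_push.
(* Inserting [y] may cut first, but a first-row entry at or above [y] survives, so [y < size r1] and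
   [blocked_ins] applies. *)
move=> z; have [r1 [[-> n1 y1 t1 h1]] _] := tab_step_ins (state_tracks s1) yr.
rewrite blocked_ins //; apply/row1_above_lt/h1; rewrite tab_step_free //.
move: xr; rewrite leq_eqVlt => /orP[/eqP ex|xr].
  by rewrite ex ins_size /= -ex yx.
by apply/blocked_row1_above/blocked_ins_le.
Qed.

(** Slots within the tableau are those creating no 4123, by [state_cut]; unblocked slots are those
    giving a descent, by [pair_code_state]. A valley slot [y <= x] stays within the tableau
    automatically. *)
Lemma pair_codeP c : is_code c -> ~~ odd (size c) ->
  pair_code c <-> alternates false (code_word c) /\ ~ has4123 (code_word c).
Proof.
move: {2}(size c) (leqnn (size c)) => n; elim: n c => [|n IH] [|y [|x c]] //;
  try by move=> *; split=> // _; split=> // -[? [? [? [? []]]]].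
rewrite [size _]/= ltnS => hc; rewrite [is_code _]/= => /and3P[yc xc ic].
rewrite [odd _]/= negbK => oc.
have {IH} IH := IH c (ltnW hc) ic oc.
have -> : alternates false (code_word [:: y, x & c]) =
  [&& y <= x, (if code_word c is v :: _ then v < x else true) & alternates false (code_word c)].
  rewrite [code_word _]/= [alternates _ _]/= !alternates_bump.
  congr [&& _, _ & _]; first by rewrite /bump; case: leqP; lia.
  by case: (code_word c) => //= v w; rewrite /bump; case: (leqP x v); case: leqP; lia.
rewrite -[code_word [:: y, x & c]]/(push y (push x (code_word c))) !has4123_push [pair_code _]/=.
split.
  move=> /and4P[pc xr nh yx]; have [_ sc hh] := pair_code_state pc.
  move/IH: (pc) => [-> av]; rewrite yx.
  have s1 := state_of_push sc xr.
  split.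
    have := hh x; rewrite (negbTE nh); rewrite -size_eq0 -size_code_word size_eq0.
    by case: (code_word c) => //= v w /esym/negbT; rewrite -ltnNge => ->.
  case=> [[//|/(state_cut sc)]|/(state_cut s1)].
    by rewrite size_code_word => /(_ xc); rewrite ltnNge xr.
  by rewrite /= size_map size_code_word tab_step_free // size_ins // => /(_ yc); lia.
move=> [/and3P[yx vx al] av].
have pc : pair_code c by apply/IH; split=> //; tauto.
have [_ sc hh] := pair_code_state pc.
have xr : x <= size (code_state c).
  rewrite leqNgt; apply/negP => h; apply: av; left; right.
  by apply/(state_cut sc) => //; rewrite size_code_word.
rewrite pc xr yx hh -size_eq0 -size_code_word size_eq0 /= andbT.
by case: (code_word c) vx => //= v w; rewrite -ltnNge.
Qed.

Fixpoint codes m : seq (seq nat) :=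
  if m is m'.+1 then [seq x :: c | c <- codes m', x <- iota 0 m'.+1] else [:: [::]].

Lemma mem_codes m c : (c \in codes m) = is_code c && (size c == m).
Proof.
elim: m c => [|m IH] c; first by case: c => //= x c; rewrite andbF.
apply/allpairsP/idP => [[p []]|].
  by rewrite IH mem_iota => /andP[h1 /eqP h2] h3 -> /=; rewrite h1 h2 eqxx !andbT -ltnS.
case: c => // x c;
have -> : is_code (x :: c) && (size (x :: c) == m.+1) =
  (x <= size c) && is_code c && (size c == m) by [].
case/andP=> /andP[h1 h2] /eqP h3.
by exists (c, x); rewrite IH mem_iota h2 h3 eqxx ltnS -h3.
Qed.

Lemma uniq_codes m : uniq (codes m).
Proof.
elim: m => // m IH; apply: allpairs_uniq => //; first exact: iota_uniq.
by move=> [c x] [c' x'] _ _ /= [-> ->].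
Qed.

Lemma sum_pair_codes phi n :
  \sum_(c <- codes n.+1.*2 | pair_code c) phi (code_state c) =
  \sum_(c <- codes n.*2 | pair_code c) add_pair phi (code_state c).
Proof.
rewrite doubleS big_mkcond [codes n.*2.+2]/codes -/codes !big_allpairs_dep.
rewrite [RHS]big_mkcond !big_seq; apply: eq_bigr => c; rewrite mem_codes => /andP[ic /eqP sc].
rewrite -[iota 0 n.*2.+1]/(index_iota 0 n.*2.+1) -[iota 0 n.*2.+2]/(index_iota 0 n.*2.+2).
case: ifP => pc; last by rewrite big1 // => x _; rewrite big1 //= => y _; rewrite pc.
have [_ /state_size h _] := pair_code_state pc; rewrite size_code_word sc in h.
have pcE x y : pair_code [:: y, x & c] = [&& x <= size (code_state c), ~~ blocked (code_state c) x & y <= x].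
  by rewrite [LHS]/= pc.
rewrite /add_pair (big_cat_nat (n := (size (code_state c)).+1)) // [LHS]addnC big_nat_cond big1 ?add0n; last first.
  by move=> x /andP[/andP[h1 _] _]; rewrite big1 // => y _; rewrite pcE leqNgt h1.
apply: eq_big_nat => x /andP[_ hx]; rewrite ltnS in hx.
case: ifP => hit_x; first by rewrite big1 // => y _; rewrite pcE hit_x andbF.
rewrite (big_cat_nat (n := x.+1)) //; last by lia.
rewrite [LHS]addnC big_nat_cond big1 ?add0n; last first.
  by move=> y /andP[/andP[h1 _] _]; rewrite pcE (leqNgt y) h1 !andbF.
apply: eq_big_nat => y /andP[_ hy]; rewrite ltnS in hy.
by rewrite pcE hx hit_x hy /= -[in RHS]tab_step_free ?hit_x.
Qed.

Lemma count_pair_codes n : count pair_code (codes n.*2) = pairings n [::].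
Proof.
rewrite -sum1_count.
suff H k : k <= n ->
    (* The pairs move one at a time from [pairings] into the code; at [k = n] each code counts
       once. *)
    \sum_(c <- codes k.*2 | pair_code c) pairings (n - k) (code_state c) = pairings n [::].
  by rewrite -(H n) // subnn.
elim: k => [|k IH] kn; first by rewrite subn0 big_cons big_nil /= addn0.
rewrite sum_pair_codes -(IH (ltnW kn)); apply: eq_bigr => c _.
by rewrite -[n - k]prednK ?subn_gt0 // -subnS.
Qed.

Lemma permword_code_word c : is_code c -> permword (code_word c).
Proof.
elim: c => [|x c IH] //= /andP[hx ic]; apply: permword_push; first exact: IH.
by rewrite size_code_word.
Qed.

Lemma code_word_inj c c' : is_code c -> is_code c' -> code_word c = code_word c' -> c = c'.
Proof.
elim: c c' => [|x c IH] [|x' c'] //= /andP[_ ic] /andP[_ ic'] [<-].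
by move/(inj_map (can_inj (@bumpK x)))/IH => ->.
Qed.

Lemma code_word_surj w : permword w -> exists2 c, is_code c & code_word c = w.
Proof.
move: {2}(size w) (erefl (size w)) => n; elim: n w => [|n IH] [|x w] //.
  by exists [::].
move=> [sw] [/= /andP[xw uw] mw].
have bK : map (bump x) (map (unbump x) w) = w.
  rewrite -map_comp -[RHS]map_id; apply/eq_in_map => v vw /=.
  by rewrite unbumpK // inE; apply: contraNneq xw => <-.
have hx : x <= size w by rewrite -ltnS -mw mem_head.
have [||c ic ec] := IH (map (unbump x) w); first by rewrite size_map.
  split; first by rewrite -(map_inj_uniq (can_inj (@bumpK x))) bK.
  move=> v; rewrite size_map; have := mw (bump x v); rewrite inE.
  have -> : (bump x v == x) = false by apply/eqP; rewrite /bump; case: leqP; lia.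
  rewrite -{1}bK mem_map; last exact: can_inj (@bumpK x).
  by move=> /= ->; rewrite /bump; case: leqP; lia.
exists (x :: c); last by rewrite /= /push ec bK.
by rewrite /= ic -(size_code_word c) ec size_map hx.
Qed.

(** * From permutations to words *)

Definition word m (p : 'S_m) : seq nat := [seq val (p i) | i <- enum 'I_m].

Lemma size_word m (p : 'S_m) : size (word p) = m.
Proof. by rewrite size_map size_enum_ord. Qed.

Lemma nth_word m (p : 'S_m) (i : 'I_m) : nth 0 (word p) i = p i.
Proof. by rewrite (nth_map i) ?size_enum_ord // nth_ord_enum. Qed.

Lemma permword_word m (p : 'S_m) : permword (word p).
Proof.
split; first by rewrite map_inj_uniq ?enum_uniq // => i j /val_inj/perm_inj.
move=> v; rewrite size_word; apply/mapP/idP => [[i _ ->]|hv]; first exact: ltn_ord.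
by exists (p^-1%g (Ordinal hv)); rewrite ?mem_enum // permKV.
Qed.

Lemma word_inj m : injective (@word m).
Proof. by move=> p q e; apply/permP => i; apply: val_inj; rewrite /= -!nth_word e. Qed.

Lemma word_surj m w : permword w -> size w = m -> exists p : 'S_m, word p = w.
Proof.
move=> [uw mw] sw; have lt (i : 'I_m) : nth 0 w i < m.
  by rewrite -{2}sw -mw mem_nth // sw.
have inj : injective (fun i => Ordinal (lt i)).
  move=> i j [] /eqP; rewrite nth_uniq ?sw // => /eqP; exact: val_inj.
exists (perm inj); apply: (@eq_from_nth _ 0) => [|i]; rewrite size_word // => hi.
by rewrite (nth_word _ (Ordinal hi)) permE.
Qed.

Lemma alternatesP b w : reflect
  (forall i, i.+1 < size w ->
     if b (+) odd i then nth 0 w i.+1 < nth 0 w i else nth 0 w i < nth 0 w i.+1)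
  (alternates b w).
Proof.
elim: w b => [|x w IH] b /=; first by apply: ReflectT.
apply: (iffP andP) => [[h1 /IH h2] [|i]|h].
- by rewrite addbF; case: w h1 {IH h2}.
- by rewrite ltnS => /h2 /=; rewrite addNb -addbN.
split; first by case: w {IH} h => //= y w /(_ 0); rewrite addbF; apply.
by apply/IH => i hi; have := h i.+1 hi; rewrite /= addNb -addbN.
Qed.

Lemma updown_word m (p : 'S_m) : updown p = alternates false (word p).
Proof.
apply/'forall_'forall_implyP/alternatesP => [h i|h i j /eqP ij].
  rewrite size_word => hi; have := h (Ordinal (ltnW hi)) (Ordinal hi) (eqxx _).
  by rewrite -!nth_word.
have := h i; rewrite size_word -ij ltn_ord => /(_ isT).
by rewrite !nth_word.
Qed.

Lemma subseq_nthP (w s : seq nat) : subseq s w <->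
  exists l, [/\ sorted ltn l, all (fun i => i < size w) l & s = map (nth 0 w) l].
Proof.
split=> [/subseqP[m sm ->]|[l [h1 h2 ->]]].
  exists (mask m (iota 0 (size w))); split.
  - by apply: (sorted_mask ltn_trans); exact: iota_ltn_sorted.
  - by apply/allP => i /mem_mask; rewrite mem_iota.
  by rewrite map_mask -/(mkseq _ _) mkseq_nth.
rewrite -{2}(mkseq_nth 0 w); apply: map_subseq.
(* A strictly increasing list of positions is recovered by filtering the list of all positions. *)
suff -> : l = filter (mem l) (iota 0 (size w)) by exact: filter_subseq.
apply: (irr_sorted_eq ltn_trans ltnn) => //.
  by apply: (sorted_filter ltn_trans); exact: iota_ltn_sorted.
move=> i; rewrite mem_filter mem_iota /= andb_idr //.
by move=> /= il; apply: (allP h2).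
Qed.

Lemma avoids4123_word m (p : 'S_m) : avoids4123 p <-> ~ has4123 (word p).
Proof.
rewrite /avoids4123; split.
  move=> /negP h [d [a [b [c [/subseq_nthP[l [hl hs el]]]]]]].
  case: l hl hs el => [|i1 [|i2 [|i3 [|i4 []]]]] //=.
  rewrite andbT => /and3P[h1 h2 h3]; rewrite size_word andbT => /and4P[k1 k2 k3 k4].
  move=> [-> -> -> ->] [/andP[g1 g2] g3]; apply: h.
  apply/existsP; exists (Ordinal k1); apply/existsP; exists (Ordinal k2).
  apply/existsP; exists (Ordinal k3); apply/existsP; exists (Ordinal k4).
  by rewrite -!nth_word /= h1 h2 h3 g1 g2 g3.
move=> h; apply/existsPn => i1; apply/existsPn => i2; apply/existsPn => i3.
apply/existsPn => i4; apply/negP => /and5P[h1 h2 h3 g1 /andP[g2 g3]]; apply: h.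
exists (val (p i1)), (val (p i2)), (val (p i3)), (val (p i4)); split; last by rewrite g1 g2 g3.
apply/subseq_nthP; exists [:: val i1; val i2; val i3; val i4].
by rewrite /= h1 h2 h3 !nth_word size_word !ltn_ord.
Qed.

Lemma card_UD4123 n : #|UD4123 n.*2| = pairings n [::].
Proof.
rewrite -count_pair_codes -size_filter cardE.
rewrite -(size_map (@word _)) -[RHS](size_map code_word); apply/perm_size/uniq_perm.
- by rewrite map_inj_uniq ?enum_uniq //; exact: word_inj.
- rewrite map_inj_in_uniq ?filter_uniq ?uniq_codes // => c c'.
  rewrite !mem_filter !mem_codes => /and3P[_ ic _] /and3P[_ ic' _]; exact: code_word_inj.
move=> w; apply/mapP/mapP => [[p]|[c]].
  rewrite mem_enum inE => /andP[ud av] ->.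
  have [c ic ec] := code_word_surj (permword_word p); have sc : size c = n.*2.
    by rewrite -size_code_word ec size_word.
  exists c => //; rewrite mem_filter mem_codes ic sc eqxx !andbT.
  apply/pair_codeP; rewrite ?sc ?odd_double // ec; split; first by rewrite -updown_word.
  exact/avoids4123_word.
rewrite mem_filter mem_codes => /and3P[pc ic /eqP sc] ->.
have [|p ep] := word_surj (permword_code_word ic) (m := n.*2); first by rewrite size_code_word.
have oc : ~~ odd (size c) by rewrite sc odd_double.
have [al av] := (pair_codeP ic oc).1 pc.
by exists p => //; rewrite mem_enum inE updown_word ep al; apply/avoids4123_word; rewrite ep.
Qed.

(** * Shifted tableaux and their row words *)

Lemma count_take_lt i k l (w : seq nat) : k < l -> k < size w -> nth 0 w k = i ->
  count_mem i (take k w) < count_mem i (take l w).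
Proof.
move=> kl kw e; rewrite -(cat_take_drop k.+1 (take l w)) take_takel // (take_nth 0 kw).
by rewrite -cats1 !count_cat /= e eqxx addn1 ltnS leq_addr.
Qed.

Lemma count_take_le i k l (w : seq nat) :
  k <= l -> count_mem i (take k w) <= count_mem i (take l w).
Proof.
by move=> kl; rewrite -(cat_take_drop k (take l w)) take_takel // count_cat leq_addr.
Qed.

(** Numbers the occurrences of [i] from 0, like the cells of row [i] from left to right;
    [occurrence_unique] makes the numbering faithful. *)
Lemma count_occurrence i m (w : seq nat) : m < count_mem i w ->
  exists2 k, k < size w & nth 0 w k = i /\ count_mem i (take k w) = m.
Proof.
elim: w m => //= a w IH m; case: (a =P i) => [->|ne] /=.
  case: m => [|m]; first by exists 0.
  by rewrite add1n ltnS => /IH[k kw [e1 e2]]; exists k.+1; rewrite //= eqxx e2.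
by rewrite add0n => /IH[k kw [e1 e2]]; exists k.+1 => //=; case: eqP.
Qed.

Lemma occurrence_unique i k l (w : seq nat) : k < size w -> l < size w ->
  nth 0 w k = i -> nth 0 w l = i ->
  count_mem i (take k w) = count_mem i (take l w) -> k = l.
Proof.
move=> kw lw ek el e; case: (ltngtP k l) => // h.
  by have := count_take_lt h kw ek; rewrite e ltnn.
by have := count_take_lt h lw el; rewrite e ltnn.
Qed.

Lemma count_take_iota i k (w : seq nat) : count_mem i (take k w) =
  count (fun l => (l < k) && (nth 0 w l == i)) (iota 0 (size w)).
Proof.
elim: w k => [|a w IH] [|k] //=; first by rewrite (eq_count (a2 := pred0)) ?count_pred0.
by rewrite IH (iotaDl 1 0) count_map; congr (_ + _); apply: eq_count => l.
Qed.

Section RowWords.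
Variable la : seq nat.
Local Notation N := (sumn la).
Local Notation cell := (shifted_cell la).

Lemma nth_le_sumn i : nth 0 la i <= N.
Proof.
elim: la i => [|x s IH] [|i] //=; first exact: leq_addr.
exact: leq_trans (IH i) (leq_addl _ _).
Qed.

Lemma cell_bounds (c : cell) :
  cell_row c < size la /\ cell_row c <= cell_col c < cell_row c + nth 0 la (cell_row c).
Proof. by split; [exact: ltn_ord|exact: (valP c)]. Qed.

Lemma cell_ex i j : i < size la -> i <= j < i + nth 0 la i ->
  exists c : cell, cell_row c = i /\ cell_col c = j.
Proof.
move=> hi hj; have hj' : j < size la + N by have := nth_le_sumn i; lia.
have h : in_shifted_diagram (Ordinal hi, Ordinal hj') by [].
by exists (exist (fun c => in_shifted_diagram c) _ h).
Qed.

Lemma cell_inj (c d : cell) : cell_row c = cell_row d -> cell_col c = cell_col d -> c = d.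
Proof.
case: c d => [[i j] h] [[i' j'] h'] /= hr hc; apply: val_inj => /=.
by congr pair; apply: val_inj.
Qed.

(** The inequality is strict because of the shift: the [m]-th cell of row [i.+1] stands below the
    [m.+1]-st cell of row [i]. *)
Definition ballot (w : seq nat) : Prop := forall k i,
  0 < count_mem i.+1 (take k w) -> count_mem i.+1 (take k w) < count_mem i (take k w).

Definition row_word (w : seq nat) : Prop :=
  [/\ size w = N, forall i, count_mem i w = nth 0 la i & ballot w].

(** The default 0 never occurs for a standard tableau, where every label is used. *)
Definition reading (t : {ffun cell -> 'I_N}) : seq nat :=
  [seq (if [pick c | t c == k] is Some c then cell_row c else 0) | k <- enum 'I_N].

Lemma size_reading t : size (reading t) = N.
Proof. by rewrite size_map size_enum_ord. Qed.

Section Tableau.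
Variable t : {ffun cell -> 'I_N}.
Hypothesis tP : t \in shifted_SYT la.

Lemma syt_bij k : exists2 c, t c = k & forall d, t d = k -> d = c.
Proof.
move: tP; rewrite inE => /and3P[/forallP/(_ k)/cards1P[c hc] _ _].
exists c; first by have := set11 c; rewrite -hc inE => /eqP.
by move=> d /eqP hd; apply/set1P; rewrite -hc inE.
Qed.

Lemma syt_inj : injective t.
Proof. by move=> c d e; have [x _ h] := syt_bij (t d); exact: etrans (h c e) (esym (h d erefl)). Qed.

Lemma syt_row c d : cell_row c = cell_row d -> cell_col c < cell_col d -> t c < t d.
Proof.
move=> h1 h2; move: tP; rewrite inE => /and3P[_ /'forall_forallP/(_ c d) + _].
by rewrite h1 eqxx h2.
Qed.

Lemma syt_col c d : cell_col c = cell_col d -> cell_row c < cell_row d -> t c < t d.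
Proof.
move=> h1 h2; move: tP; rewrite inE => /and3P[_ _ /'forall_forallP/(_ c d)].
by rewrite h1 eqxx h2.
Qed.

Lemma nth_reading c : nth 0 (reading t) (t c) = cell_row c.
Proof.
rewrite (nth_map (t c)) ?size_enum_ord // nth_ord_enum.
case: pickP => [d /eqP/syt_inj -> //|/(_ c)]; by rewrite eqxx.
Qed.

(** The cells of row [i] with label below [k] are counted twice: by their columns, an interval of
    length [m], and by their labels, the positions of the letter [i]. *)
Lemma count_reading i k m : i < size la -> m <= nth 0 la i ->
  (forall c, cell_row c = i -> (t c < k) = (cell_col c < i + m)) ->
  count_mem i (take k (reading t)) = m.
Proof.
move=> hi hm hk.
pose s := [seq c <- enum cell | (cell_row c == i) && (t c < k)].
have us : uniq s by apply: filter_uniq; exact: enum_uniq.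
have -> : m = size s.
  rewrite -[LHS](size_iota i) -[RHS](size_map (@cell_col la)); apply/perm_size/uniq_perm.
  - exact: iota_uniq.
  - rewrite map_inj_in_uniq // => c d.
    rewrite !mem_filter => /andP[/andP[/eqP hc _] _] /andP[/andP[/eqP hd _] _] e.
    by apply: cell_inj; rewrite ?hc.
  move=> j; rewrite mem_iota; apply/idP/mapP => [hj|[c]].
    have [|c [hr hc]] := @cell_ex i j hi; first by lia.
    by exists c => //; rewrite mem_filter mem_enum hr eqxx hk // hc; case/andP: hj => _ ->.
  rewrite mem_filter => /andP[/andP[/eqP hr]]; rewrite hk // => h _ ->; rewrite h andbT.
  by have [_ /andP[+ _]] := cell_bounds c; rewrite hr => ->.
have -> : count_mem i (take k (reading t)) =
   size [seq l : 'I_N <- enum 'I_N | (l < k) && (nth 0 (reading t) l == i)].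
  by rewrite count_take_iota size_reading -val_enum_ord count_map size_filter.
rewrite -(size_map (fun c => t c) s); apply/perm_size/uniq_perm.
- by rewrite filter_uniq ?enum_uniq.
- by rewrite (map_inj_uniq syt_inj).
move=> l; rewrite mem_filter mem_enum andbT; apply/idP/mapP => [/andP[lk /eqP e]|[c]].
  have [c ec _] := syt_bij l; exists c => //.
  by rewrite mem_filter mem_enum -nth_reading ec e eqxx lk.
by rewrite mem_filter => /andP[/andP[/eqP h1 h2] _] ->; rewrite nth_reading h1 h2 eqxx.
Qed.

Lemma count_reading_cell c :
  count_mem (cell_row c) (take (t c) (reading t)) = cell_col c - cell_row c.
Proof.
have [h1 h2] := cell_bounds c; apply: count_reading => //; first by lia.
move=> d hd; have -> : cell_row c + (cell_col c - cell_row c) = cell_col c by lia.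
apply/idP/idP => [|h]; last exact: syt_row.
apply: contraTT; rewrite -!leqNgt leq_eqVlt => /orP[/eqP e|h].
  by rewrite (@cell_inj c d).
by apply/ltnW/syt_row.
Qed.

Lemma row_word_reading :
  (forall i, i.+1 < size la -> nth 0 la i.+1 < nth 0 la i) -> row_word (reading t).
Proof.
move=> strict; split; first exact: size_reading.
  move=> i; case: (ltnP i (size la)) => hi; last first.
    rewrite nth_default //; apply/count_memPn/(nthP 0) => -[k].
    rewrite size_reading => kN e; have [c ec _] := syt_bij (Ordinal kN).
    by have := nth_reading c; rewrite ec /= e; have [+ _] := cell_bounds c; lia.
  rewrite -{1}(take_size (reading t)); apply: count_reading => // c hc.
  rewrite size_reading ltn_ord; have [_ h] := cell_bounds c.
  by rewrite -hc; case/andP: h => _ ->.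
move=> k i; set m := count_mem i.+1 _ => m0.
have m1 : m.-1 < m by rewrite prednK.
(* The last of the [m] letters [i.+1] is a cell [c] in column [i + m]. The cell [d] above it has a
   smaller label and [m] letters [i] before it, so the prefix has more than [m] letters [i]. *)
have [l] := @count_occurrence i.+1 m.-1 (take k (reading t)) m1.
rewrite size_take size_reading => hl [e1 e2].
have lk : l < k by move: hl; case: (ltnP k N); lia.
have lN : l < N by move: hl; case: (ltnP k N); lia.
move: e1 e2; rewrite nth_take // (take_takel _ (ltnW lk)) => e1 e2.
have [c ec _] := syt_bij (Ordinal lN).
have rc : cell_row c = i.+1 by rewrite -nth_reading ec.
have := count_reading_cell c; rewrite ec rc e2 => hm.
have [h1 h2] := cell_bounds c.
have [||d [rd cd]] := @cell_ex i (cell_col c); first by lia.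
  by have := strict i; rewrite rc in h1 h2; lia.
have dc : t d < t c by apply: syt_col; rewrite ?cd // rd rc.
have := count_reading_cell d; rewrite rd cd => hd.
have := @count_take_lt i (t d) k (reading t).
rewrite hd size_reading nth_reading rd; move: dc; rewrite ec /= => dc.
move=> /(_ ltac:(lia) (ltn_ord _) erefl); rewrite rc in h2; lia.
Qed.

End Tableau.

(** The label of a cell is the position of the letter [cell_row c] preceded by exactly
    [cell_col c - cell_row c] equal letters. *)
Lemma reading_inj : {in shifted_SYT la &, injective reading}.
Proof.
move=> t u ht hu e; apply/ffunP => c; apply: val_inj.
apply: (@occurrence_unique (cell_row c) _ _ (reading t)); rewrite ?size_reading ?ltn_ord //=.
- by rewrite nth_reading.
- by rewrite e nth_reading.
- by rewrite count_reading_cell // e count_reading_cell.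
Qed.

Lemma reading_surj w : row_word w -> exists2 t, t \in shifted_SYT la & reading t = w.
Proof.
move=> [sw cw bw].
have ex (c : cell) : exists k : 'I_N, (nth 0 w k == cell_row c) &&
    (count_mem (cell_row c) (take k w) == cell_col c - cell_row c).
  have [h1 h2] := cell_bounds c.
  have [|k kw [e1 e2]] := @count_occurrence (cell_row c) (cell_col c - cell_row c) w.
    by rewrite cw; lia.
  by rewrite sw in kw; exists (Ordinal kw); rewrite /= e1 e2 !eqxx.
pose t := [ffun c => xchoose (ex c)].
have tP c : nth 0 w (t c) = cell_row c /\
    count_mem (cell_row c) (take (t c) w) = cell_col c - cell_row c.
  by rewrite ffunE; case/andP: (xchooseP (ex c)) => /eqP -> /eqP ->.
have tlt c k : cell_col c - cell_row c < count_mem (cell_row c) (take k w) -> t c < k.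
  move=> h; rewrite ltnNge; apply/negP => /(count_take_le (cell_row c) w).
  by have [_ ->] := tP c; lia.
have cinj c d : t c = t d -> c = d.
  move=> e; have [r1 c1] := tP c; have [r2 c2] := tP d.
  have er : cell_row c = cell_row d by rewrite -r1 e.
  apply: cell_inj => //; rewrite -er -e in c2; rewrite c2 in c1.
  by have [_ h1] := cell_bounds c; have [_ h2] := cell_bounds d; lia.
have tk k : exists c, t c = k.
  have kw : k < size w by rewrite sw.
  have kw2 := @count_take_lt (nth 0 w k) k (size w) w kw kw erefl.
  rewrite take_size cw in kw2.
  have hs : nth 0 w k < size la by rewrite ltnNge; apply/negP => h; rewrite (nth_default _ h) ltn0 in kw2.
  have [|c [rc cc]] := @cell_ex _ (nth 0 w k + count_mem (nth 0 w k) (take k w)) hs; first by lia.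
  exists c; apply: val_inj; have [r1 c1] := tP c.
  apply: (@occurrence_unique (cell_row c) _ _ w); rewrite ?sw ?ltn_ord //=.
  by rewrite c1 rc cc addKn.
have tS : t \in shifted_SYT la.
  rewrite inE; apply/and3P; split.
  - apply/forallP => k; have [c ec] := tk k; apply/cards1P; exists c.
    by apply/setP => d; rewrite !inE -ec; apply/eqP/eqP => [/cinj|->].
  - apply/'forall_'forall_implyP => c d /eqP hr; apply/implyP => hc.
    apply: tlt; rewrite hr; have [_ ->] := tP d.
    have [_ h1] := cell_bounds c; have [_ h2] := cell_bounds d; lia.
  apply/'forall_'forall_implyP => c d /eqP hc; apply/implyP => hr.
  have [r2 c2] := tP d; have [_ h1] := cell_bounds c; have [_ h2] := cell_bounds d.
  have tdw : t d < size w by rewrite sw.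
  (* Climbs from the row of [d] one row at a time; each step uses [ballot] on the prefix ending with
     the letter of [d]. *)
  have cnt i : i <= cell_row d ->
      cell_col d - i < count_mem i (take (t d).+1 w).
    move=> hi; have -> : i = cell_row d - (cell_row d - i) by lia.
    elim: (cell_row d - i) => [|n IH].
      rewrite subn0 -c2; exact: count_take_lt.
    case: (ltnP n (cell_row d)) => hn; last first.
      by have <- : cell_row d - n = cell_row d - n.+1 by lia.
    have e : cell_row d - n = (cell_row d - n.+1).+1 by lia.
    rewrite e in IH; have := bw (t d).+1 (cell_row d - n.+1); lia.
  apply: tlt; rewrite hc; apply: leq_trans (cnt _ (ltnW hr)) _.
  (* The last letter of that prefix belongs to the lower row of [d], so dropping it does not change
     the count for the row of [c]. *)
  rewrite (take_nth 0) // r2 -cats1 count_cat /= addn0.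
  by rewrite (gtn_eqF hr) !addn0.
exists t => //; apply: (@eq_from_nth _ 0); rewrite size_reading // => k kN.
have [c ec] := tk (Ordinal kN); have -> : k = t c by rewrite ec.
by rewrite nth_reading //; have [->] := tP c.
Qed.

End RowWords.

(** * Ballot words in three letters and the shifted product formula *)

Definition strict_shape x y z := ((y == 0) || (y < x)) && ((z == 0) || (z < y)).

(** Recursion on the last letter, the row of the largest label, checks the shape of every prefix and
    yields the recurrence that removes one corner. *)
Fixpoint words3 N x y z : seq (seq nat) :=
  if strict_shape x y z then
    if N is N'.+1 then
      (if x is x'.+1 then [seq rcons w 0 | w <- words3 N' x' y z] else [::]) ++
      (if y is y'.+1 then [seq rcons w 1 | w <- words3 N' x y' z] else [::]) ++
      (if z is z'.+1 then [seq rcons w 2 | w <- words3 N' x y z'] else [::])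
    else if x + y + z is 0 then [:: [::]] else [::]
  else [::].

Definition counts3 w x y z := [/\ count_mem 0 w = x, count_mem 1 w = y & count_mem 2 w = z].

Lemma ballot_rcons w a : ballot (rcons w a) <-> ballot w /\
  forall i, 0 < count_mem i.+1 (rcons w a) ->
     count_mem i.+1 (rcons w a) < count_mem i (rcons w a).
Proof.
split=> [h|[h1 h2] k i].
  split=> [k i|i]; last by have := h (size (rcons w a)) i; rewrite take_size; apply.
  case: (leqP k (size w)) => hk; first by have := h k i; rewrite -cats1 takel_cat //; apply.
  rewrite (take_oversize (ltnW hk)).
  by have := h (size w) i; rewrite -cats1 takel_cat // take_size; apply.
case: (leqP k (size w)) => hk; first by rewrite -cats1 takel_cat //; apply: h1.
by rewrite take_oversize ?size_rcons //; apply: h2.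
Qed.

Lemma count_mem_rcons (w : seq nat) a i : count_mem i (rcons w a) = (a == i) + count_mem i w.
Proof. by rewrite -cats1 count_cat /= addn0 addnC. Qed.

Lemma count_mem_all_lt3 (w : seq nat) i : all (fun a => a < 3) w -> count_mem i.+3 w = 0.
Proof. by move=> /allP h; apply/count_memPn/negP => /h. Qed.

Lemma mem_words3 N w x y z : w \in words3 N x y z <->
  [/\ size w = N, all (fun a => a < 3) w, counts3 w x y z & ballot w].
Proof.
elim: N w x y z => [|N IH] w x y z.
  split.
    rewrite /=; case: ifP => // _; case e: (x + y + z) => //; rewrite inE => /eqP ->.
    by split=> //; first by [rewrite /counts3 /=; split; lia]; case.
  by case: w => [|? ?] [] // _ _ [<- <- <-] _.
case/lastP: w => [|w a].
  split=> [|[]//]; rewrite /=; case: ifP => // _.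
  rewrite !mem_cat => /or3P[]; [case: x => // x|case: y => // y|case: z => // z];
  by move=> /mapP[[|? ?]].
have step3 (b : nat) (l : seq (seq nat)) :
    (rcons w a \in [seq rcons v b | v <- l]) = (a == b) && (w \in l).
  apply/mapP/andP => [[v hv /rcons_inj[-> ->]]|[/eqP -> h]]; first by rewrite eqxx.
  by exists w.
have -> : (rcons w a \in words3 N.+1 x y z) = strict_shape x y z &&
  [|| (0 < x) && (a == 0) && (w \in words3 N x.-1 y z),
      (0 < y) && (a == 1) && (w \in words3 N x y.-1 z)
    | (0 < z) && (a == 2) && (w \in words3 N x y z.-1)].
  rewrite [words3 N.+1 _ _ _]/=; case: ifP => // _; rewrite !mem_cat.
  by congr [|| _, _ | _]; [case: x|case: y|case: z] => // ?; rewrite step3.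
rewrite size_rcons all_rcons /counts3 !count_mem_rcons.
split.
  move=> /andP[ss H].
  have [a3 [sw aw [e0 e1 e2] bw]] : a < 3 /\ [/\ size w = N, all (fun a => a < 3) w,
      [/\ (a == 0) + count_mem 0 w = x, (a == 1) + count_mem 1 w = y
        & (a == 2) + count_mem 2 w = z] & ballot w].
    by case/or3P: H => /andP[/andP[p0 /eqP ->] /IH[-> -> [-> -> ->] bw]];
       split=> //; split=> //; split=> //=; rewrite ?add0n // add1n prednK.
  split; rewrite ?sw ?a3 ?aw //; apply/ballot_rcons; split=> // -[|[|i]]; rewrite !count_mem_rcons ?e0 ?e1 ?e2.
  - by move: ss; rewrite /strict_shape; lia.
  - by move: ss; rewrite /strict_shape; lia.
  by rewrite count_mem_all_lt3 //; case: a a3 {H step3 e0 e1 e2} => [|[|[|]]].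
move=> [[sN] /andP[a3 aw] [e0 e1 e2] /ballot_rcons[bw h]].
have ss : strict_shape x y z.
  by have := h 0; have := h 1; rewrite !count_mem_rcons e0 e1 e2 /strict_shape; lia.
rewrite ss /=; apply/or3P.
have a012 : [\/ a = 0, a = 1 | a = 2].
  by case: a a3 {e0 e1 e2 h step3} => [|[|[|]]] // _; [apply: Or31|apply: Or32|apply: Or33].
case: a012 e0 e1 e2 => -> e0 e1 e2; [apply: Or31|apply: Or32|apply: Or33];
  rewrite eqxx andbT; apply/andP; (split; first by move: e0 e1 e2 => /=; lia);
  by apply/IH; split=> //; split; move: e0 e1 e2 => /=; lia.
Qed.

Lemma uniq_words3 N x y z : uniq (words3 N x y z).
Proof.
have dis b c (l l' : seq (seq nat)) : b != c ->
    has (mem [seq rcons w b | w <- l]) [seq rcons w c | w <- l'] = false.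
  move=> bc; apply/negbTE/hasPn => _ /mapP[w _ ->]; apply/mapP => -[v _ /rcons_inj[_ e]].
  by rewrite e eqxx in bc.
have u3 (l0 l1 l2 : seq (seq nat)) : uniq l0 -> uniq l1 -> uniq l2 ->
    uniq ([seq rcons w 0 | w <- l0] ++ [seq rcons w 1 | w <- l1] ++ [seq rcons w 2 | w <- l2]).
  move=> u0 u1 u2; rewrite !cat_uniq has_cat (dis 0 1) // (dis 0 2) // (dis 1 2) //.
  by rewrite !(map_inj_uniq (rcons_injl _)) u0 u1 u2.
elim: N x y z => [|N IH] x y z; rewrite [words3 _ _ _ _]/=; case: ifP => // _.
  by case: (x + y + z).
have IH' (b : bool) x' y' z' : uniq (if b then words3 N x' y' z' else [::]) by case: b.
have := u3 _ _ _ (IH' (0 < x) x.-1 y z) (IH' (0 < y) x y.-1 z) (IH' (0 < z) x y z.-1).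
by case: x => [|x]; case: y => [|y]; case: z => [|z].
Qed.

Definition nwords3 x y z := size (words3 (x + y + z) x y z).

Lemma nwords3_bad x y z : ~~ strict_shape x y z -> nwords3 x y z = 0.
Proof. by rewrite /nwords3; case: (x + y + z) => [|N] /= /negbTE ->. Qed.

Lemma nwords3_rec x y z : strict_shape x y z -> 0 < x + y + z ->
  nwords3 x y z = (if x is x'.+1 then nwords3 x' y z else 0) +
    (if y is y'.+1 then nwords3 x y' z else 0) +
    (if z is z'.+1 then nwords3 x y z' else 0).
Proof.
rewrite /nwords3 => ss; case e: (x + y + z) => [|N] // _; rewrite [LHS]/= ss.
rewrite !size_cat addnA; congr (_ + _ + _).
- by case: x e {ss} => // x e; rewrite size_map; congr (size (words3 _ _ _ _)); lia.
- by case: y e {ss} => // y e; rewrite size_map; congr (size (words3 _ _ _ _)); lia.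
- by case: z e {ss} => // z e; rewrite size_map; congr (size (words3 _ _ _ _)); lia.
Qed.

(* Separate from the general formula below, whose factor [y + z] vanishes at
   [y = z = 0]. *)
Lemma nwords3_2rows x y : y <= x.+1 ->
  nwords3 x.+1 y 0 * (x.+1`! * y`!) = (x + y)`! * (x.+1 - y).
Proof.
move: {2}(x + y) (erefl (x + y)) => n; elim: n x y => [|n IH] x y e yx.
  by have [-> ->] : x = 0 /\ y = 0 by lia.
move: yx; rewrite leq_eqVlt => /orP[/eqP ->|yx].
  by rewrite nwords3_bad ?subnn ?muln0 // /strict_shape; lia.
rewrite nwords3_rec //; last by rewrite /strict_shape; lia.
rewrite addn0 mulnDl.
have h1 : nwords3 x y 0 * (x.+1`! * y`!) = n`! * (x.+1 * (x - y)).
  case: x e yx => [|x] e yx; first by lia.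
  have e' : x + y = n by lia.
  have := IH x y e' yx; rewrite e' => h.
  by rewrite [x.+2`!]factS [RHS]mulnCA -h; ring.
have h2 : (if y is y'.+1 then nwords3 x.+1 y' 0 else 0) * (x.+1`! * y`!) =
    n`! * (y * (x.+2 - y)).
  case: y e yx {h1} => [|y] e yx; first by rewrite muln0.
  have e' : x + y = n by lia.
  have := IH x y e' (ltnW (ltnW yx)); rewrite e' => h.
  by rewrite [y.+1`!]factS subSS [RHS]mulnCA -h; ring.
rewrite h1 h2 e factS -mulnDr -mulnA [RHS]mulnCA; congr (_ * _).
have [d ex] : exists d, x = y + d by exists (x - y); lia.
rewrite {h1 h2}ex in e *.
have -> : n.+1 = y + d + y by lia.
have -> : y + d - y = d by lia.
have -> : (y + d).+1 - y = d.+1 by lia.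
have -> : (y + d).+2 - y = d.+2 by lia.
ring.
Qed.

Import GRing.Theory Num.Theory.

Section ThreeRows.
Local Open Scope ring_scope.
Local Notation "n %:q" := (n%:R : rat) (at level 2).

Lemma natq_neq0 n : (0 < n)%N -> n%:q != 0.
Proof. by rewrite pnatr_eq0 -lt0n. Qed.

Lemma nwords3_formula x y z : (z <= y <= x)%N -> (0 < y)%N ->
  (nwords3 x y z)%:q * ((x`!)%:q * (y`!)%:q * (z`!)%:q)
    * ((x + y)%:q * (y + z)%:q * (x + z)%:q) =
  ((x + y + z)`!)%:q * ((x%:q - y%:q) * (y%:q - z%:q) * (x%:q - z%:q)).
Proof.
move: {2}(x + y + z)%N (erefl (x + y + z)%N) => n; elim: n x y z => [|n IH] x y z e.
  by lia.
move=> /andP[zy yx] y0.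
(* For [z = 0] the factors with [z] reduce to [x] and [y] on both sides, leaving the two-row
   formula. *)
case: z e zy => [|z] e zy.
  case: x e yx => [|x] e yx; first by lia.
  have e' : (x + y)%N = n by lia.
  have h : (nwords3 x.+1 y 0)%:q * ((x.+1`!)%:q * (y`!)%:q) = (n`!)%:q * (x.+1%:q - y%:q).
    by rewrite -natrB // -!natrM nwords3_2rows // e'.
  rewrite e; have -> : (n.+1`!)%:q = n.+1%:q * (n`!)%:q by rewrite -natrM -factS.
  rewrite -e !addn0 fact0 subr0.
  move: (x.+1`!)%:q (y`!)%:q (n`!)%:q (nwords3 x.+1 y 0)%:q h => fx fy fn g h.
  have -> : g * (fx * fy * 1) * ((x.+1 + y)%:q * y%:q * x.+1%:q) =
    g * (fx * fy) * ((x.+1 + y)%:q * y%:q * x.+1%:q) by ring.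
  by rewrite h subr0; ring.
case: (eqVneq x y) => [->|xy].
  by rewrite nwords3_bad ?subrr ?mul0r ?mulr0 // /strict_shape; lia.
case: (eqVneq y z.+1) => [->|yz].
  by rewrite nwords3_bad ?subrr ?(mul0r, mulr0) // /strict_shape; lia.
rewrite nwords3_rec; [|by rewrite /strict_shape; lia|by lia].
case: x y e xy yz zy yx y0 => [|x] [|y] e xy yz zy yx y0; try by lia.
have := IH x y.+1 z.+1 ltac:(lia) ltac:(lia) ltac:(lia).
have := IH x.+1 y z.+1 ltac:(lia) ltac:(lia) ltac:(lia).
have := IH x.+1 y.+1 z ltac:(lia) ltac:(lia) ltac:(lia).
have -> : (x + y.+1 + z.+1 = n)%N by lia.
have -> : (x.+1 + y + z.+1 = n)%N by lia.
have -> : (x.+1 + y.+1 + z = n)%N by lia.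
rewrite e !factS !natrM !natrD.
have -> : n.+1%:q = x.+1%:q + y.+1%:q + z.+1%:q by rewrite -!natrD e.
have f0 k : (k`!)%:q != 0 by rewrite natq_neq0 ?fact_gt0.
have := f0 x; have := f0 y; have := f0 z.
move: (n`!)%:q (x`!)%:q (y`!)%:q (z`!)%:q => fn fx fy fz nz ny nx.
move: (nwords3 x y.+1 z.+1)%:q (nwords3 x.+1 y z.+1)%:q (nwords3 x.+1 y.+1 z)%:q => g1 g2 g3.
have -> : x.+1%:q = x%:q + 1 by rewrite -natr1.
have -> : y.+1%:q = y%:q + 1 by rewrite -natr1.
have -> : z.+1%:q = z%:q + 1 by rewrite -natr1.
have x1 : 0 < x%:q by rewrite ltr0n; lia.
have y1 : 0 < y%:q by rewrite ltr0n; lia.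
have z1 : 0 <= z%:q by rewrite ler0n.
move: (x%:q) (y%:q) (z%:q) x1 y1 z1 => X Y Z x1 y1 z1 h3 h2 h1.
clear IH e xy yz zy yx y0 f0.
(* Each smaller count is solved from its induction hypothesis; a rational identity in [X], [Y], [Z]
   remains. *)
have -> : g1 = fn * ((X - (Y + 1)) * (Y + 1 - (Z + 1)) * (X - (Z + 1))) /
  (fx * ((Y + 1) * fy) * ((Z + 1) * fz) * ((X + (Y + 1)) * (Y + 1 + (Z + 1)) * (X + (Z + 1)))).
  rewrite -h1; field; rewrite nx ny nz /=;
    repeat (apply/andP; split) => //; apply: lt0r_neq0; lra.
have -> : g2 = fn * ((X + 1 - Y) * (Y - (Z + 1)) * (X + 1 - (Z + 1))) /
  ((X + 1) * fx * fy * ((Z + 1) * fz) * ((X + 1 + Y) * (Y + (Z + 1)) * (X + 1 + (Z + 1)))).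
  rewrite -h2; field; rewrite nx ny nz /=;
    repeat (apply/andP; split) => //; apply: lt0r_neq0; lra.
have -> : g3 = fn * ((X + 1 - (Y + 1)) * (Y + 1 - Z) * (X + 1 - Z)) /
  ((X + 1) * fx * ((Y + 1) * fy) * fz * ((X + 1 + (Y + 1)) * (Y + 1 + Z) * (X + 1 + Z))).
  rewrite -h3; field; rewrite nx ny nz /=;
    repeat (apply/andP; split) => //; apply: lt0r_neq0; lra.
field; rewrite nx ny nz /=;
    repeat (apply/andP; split) => //; apply: lt0r_neq0; lra.
Qed.
End ThreeRows.

Lemma row_word3 x y z w :
  row_word [:: x; y; z] w <-> w \in words3 (x + y + z) x y z.
Proof.
rewrite mem_words3 /row_word /= addn0 addnA; split=> [[sw cw bw]|[sw aw [c0 c1 c2] bw]].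
  split=> //.
  apply/allP => a aw; rewrite ltnNge; apply/negP => h.
  move: aw; rewrite -has_pred1 has_count cw.
  by case: a h => [|[|[|a]]] //= _; rewrite nth_nil.
split=> // -[|[|[|i]]] //=; rewrite nth_nil.
exact: count_mem_all_lt3.
Qed.

Lemma card_shifted_SYT3 x y z : z < y < x ->
  #|shifted_SYT [:: x; y; z]| = nwords3 x y z.
Proof.
move=> /andP[zy yx]; rewrite cardE -(size_map (@reading _)); apply/perm_size/uniq_perm.
- rewrite map_inj_in_uniq ?enum_uniq // => t u; rewrite !mem_enum; exact: reading_inj.
- exact: uniq_words3.
move=> w; apply/mapP/idP => [[t]|].
  rewrite mem_enum => ht ->; apply/row_word3/row_word_reading => //.
  by case=> [|[|i]].
move=> /row_word3/reading_surj[t ht <-]; by exists t; rewrite ?mem_enum.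
Qed.

(** * Comparison of the two product formulas *)

Section Comparison.
Local Open Scope ring_scope.
Local Notation "n %:q" := (n%:R : rat) (at level 2).

(** Both sides equal [2 (3n)! / ((n+2)! (n+1)! n!)], since [(n+1)! = (n+1) n (n-1) (n-2)!]. *)
Lemma pairings_nwords3 n : (2 <= n)%N -> pairings n [::] = nwords3 (n + 2)%N n (n - 2)%N.
Proof.
case: n => [|[|m]] // _; have := pairings_nil m.+2.
have -> : (m.+2 * 3 = m.+2 + 2 + m.+2 + (m.+2 - 2))%N by lia.
have -> : (m.+2 - 2 = m)%N by lia.
move=> hP.
have hg := @nwords3_formula (m.+2 + 2)%N m.+2 m ltac:(lia) isT.
have hP' : (pairings m.+2 [::])%:q * (((m.+2 + 2)`!)%:q * (m.+2`!)%:q * (m`!)%:q)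
    * (m.+3%:q * m.+2%:q * m.+1%:q) = 2 * ((m.+2 + 2 + m.+2 + m)`!)%:q.
  rewrite -!natrM -hP addn2 [m.+3`!]factS; congr (_%:R).
  have -> : (m.+2)`! = (m.+2 * (m.+1 * m`!))%N by rewrite !factS.
  by move: (m.+4`!) (m`!) (pairings _ _) => u v P; ring.
have [x0 y0 z0] : [/\ ((m.+2 + 2)`!)%:q != 0, (m.+2`!)%:q != 0 & (m`!)%:q != 0].
  by split; rewrite natq_neq0 ?fact_gt0.
apply/eqP; rewrite -(eqr_nat rat); apply/eqP.
move: hP' hg x0 y0 z0.
move: (pairings _ _)%:q (nwords3 _ _ _)%:q ((m.+2 + 2)`!)%:q (m.+2`!)%:q (m`!)%:q => P g fx fy fz.
move: ((_ + m)`!)%:q => F hP' hg x0 y0 z0.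
have D0 : fx * fy * fz * (m.+3%:q * m.+2%:q * m.+1%:q) != 0.
  by rewrite !mulf_neq0 ?natq_neq0.
apply: (mulIf D0); rewrite [LHS]mulrA [RHS]mulrA hP'.
have {}hg : g * (fx * fy * fz) * (m.+3%:q * m.+2%:q * m.+1%:q) = 2 * F.
  (* The pairwise sums of the parts are [2n+2], [2n-2] and [2n], with product [8 (n+1) (n-1) n]; the
     differences 2, 2 and 4 multiply to 16. *)
  apply: (@mulIf _ (8 : rat)) => //.
  rewrite (_ : 2 * F * 8 = F * (2 * 2 * 4)); last by ring.
  have -> : 2 = (m.+2 + 2)%:q - m.+2%:q by rewrite natrD; ring.
  have {2}-> : (m.+2 + 2)%:q - m.+2%:q = m.+2%:q - m%:q by rewrite natrD -!natr1; ring.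
  have -> : 4 = (m.+2 + 2)%:q - m%:q by rewrite natrD -!natr1; ring.
  by rewrite -hg !natrD -!natr1; ring.
by rewrite hg.
Qed.
End Comparison.

Lemma eq_card_bijection (T U : finType) : #|T| = #|U| -> exists f : T -> U, bijective f.
Proof.
move=> e; exists (fun x => enum_val (cast_ord e (enum_rank x))).
exists (fun y => enum_val (cast_ord (esym e) (enum_rank y))) => x.
  by rewrite enum_valK cast_ordK enum_rankK.
by rewrite enum_valK cast_ordKV enum_rankK.
Qed.

Theorem theorem3p5 (n : nat) (hn : 2 <= n) :
  exists f : {p : 'S_(2 * n) | p \in UD4123 (2 * n)} ->
             {t : {ffun shifted_cell [:: n + 2; n; n - 2] ->
                        'I_(sumn [:: n + 2; n; n - 2])} |
                t \in shifted_SYT [:: n + 2; n; n - 2]},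
    bijective f.
Proof.
apply: eq_card_bijection; rewrite !card_sig.
rewrite (eq_card (B := mem (UD4123 (2 * n)))) //
  [RHS](eq_card (B := mem (shifted_SYT [:: n + 2; n; n - 2]))) //.
rewrite card_shifted_SYT3; last by lia.
by rewrite -pairings_nwords3 // mul2n card_UD4123.
Qed.
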